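(* Let $\mathscr C$ be a hereditary class of ordered binary structures. If some quantifier-free formula defines large grids in $\mathscr C$, then for arbitrarily large $n$, $\mathscr C$ contains a regular $n\times n$-semigrid.
   Context: Binary structures are over a finite relational signature $\Sigma$ with symbols of arity $\le2$ containing $\le$, interpreted as a total order; hereditary means closed under isomorphism and induced substructures. Grids: for $\phi(\bar x,\bar y,z)$ ($z$ a single variable), an $n\times n$ grid defined by $\phi$ in $S$ is $A\subseteq S^{\bar x}$, $B\subseteq S^{\bar y}$, $C\subseteq S$, $|A|=|B|=n$, $|C|=n^2$, such that $\{(\bar a,\bar b,c)\in A\times B\times C: S\models\phi(\bar a,\bar b,c)\}$ is the graph of a bijection $A\times B\to C$; $\phi$ defines large grids in $\mathscr C$ if it defines an $n\times n$ grid in some member of $\mathscr C$ for every $n$. Regular semigrids: let $[k]=\{0,\dots,k-1\}$, $C=[m+1]\times[n+1]$, $B=\{0\}\times[n+1]$, $\pi(i,j)=(0,j)$, and quasi-orders $(i,j)\le_1(i',j')\iff i\le i'$, $(i,j)\le_2(i',j')\iff j\le j'$. A regular $m\times n$-semigrid is an ordered $\Sigma$-structure with domain $C$ (up to isomorphism) whose order $\le$ is the lexicographic order on $[m+1]\times[n+1]$ or its inverse, such that for all $a,b\in B$ and $p,q\in C\setminus B$: (1) the atomic type of $(a,b)$ depends only on the atomic type of $(a,b)$ in $(B,\le)$; (2) the atomic type of $(p,q)$ depends only on the atomic type of $(p,q)$ in $(C,\le_1,\le_2)$; (3) the atomic type of $(p,b)$ depends only on the atomic type of $(\pi(p),b)$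 in $(B,\le)$, and is non-constant. The atomic type of a tuple is the set of atomic formulas and negated atomic formulas it satisfies. *)

(* Defs.v *)
From mathcomp Require Import all_boot all_order.
From mathcomp Require Import boolp classical_sets functions cardinality.

Set Implicit Arguments.
Unset Strict Implicit.
Unset Printing Implicit Defensive.

Local Open Scope classical_set_scope.
Local Open Scope card_scope.

(* A finite relational signature whose symbols have arity at most 2, presented
   as the finite types of its symbols of arity 0, 1 and 2.  The order symbol of
   an ordered signature is a distinguished element of [sym2]. *)
Record signature := Signature {
  sym0 : finType;
  sym1 : finType;
  sym2 : finType
}.

Record interp (Sg : signature) (T : Type) := Interp {
  rel0 : sym0 Sg -> Prop;
  rel1 : sym1 Sg -> T -> Prop;
  rel2 : sym2 Sg -> T -> T -> Prop
}.

Record structure (Sg : signature) := Structure {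
  dom :> Type;
  inter : interp Sg dom
}.

Definition isomorphic (Sg : signature) (S T : structure Sg) : Prop :=
  exists f : S -> T, bijective f /\
    [/\ forall s, rel0 (inter S) s <-> rel0 (inter T) s,
        forall s x, rel1 (inter S) s x <-> rel1 (inter T) s (f x) &
        forall s x y, rel2 (inter S) s x y <-> rel2 (inter T) s (f x) (f y)].

Definition induced (Sg : signature) (S : structure Sg) (A : set S) :
    structure Sg :=
  @Structure Sg A (Interp (T := A)
    (fun s => rel0 (inter S) s)
    (fun s x => rel1 (inter S) s (val x))
    (fun s x y => rel2 (inter S) s (val x) (val y))).

Definition hereditary (Sg : signature) (C : structure Sg -> Prop) : Prop :=
  (forall S T : structure Sg, isomorphic S T -> C S -> C T) /\
  (forall (S : structure Sg) (A : set S), C S -> C (induced A)).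

Definition total_order (T : Type) (R : T -> T -> Prop) : Prop :=
  [/\ forall x, R x x,
      forall x y, R x y -> R y x -> x = y,
      forall x y z, R x y -> R y z -> R x z &
      forall x y, R x y \/ R y x].

Definition ordered (Sg : signature) (le : sym2 Sg) (S : structure Sg) : Prop :=
  total_order (rel2 (inter S) le).

Inductive atom (Sg : signature) (V : Type) :=
  | AEq of V & V
  | ARel0 of sym0 Sg
  | ARel1 of sym1 Sg & V
  | ARel2 of sym2 Sg & V & V.

Inductive qf (Sg : signature) (V : Type) :=
  | QAtom of atom Sg V
  | QFalse
  | QNot of qf Sg V
  | QAnd of qf Sg V & qf Sg V
  | QOr of qf Sg V & qf Sg V.

Arguments QFalse {Sg V}.

Definition sat_atom (Sg : signature) (T V : Type) (I : interp Sg T)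
    (v : V -> T) (a : atom Sg V) : Prop :=
  match a with
  | AEq x y => v x = v y
  | ARel0 s => rel0 I s
  | ARel1 s x => rel1 I s (v x)
  | ARel2 s x y => rel2 I s (v x) (v y)
  end.

Fixpoint sat (Sg : signature) (T V : Type) (I : interp Sg T)
    (v : V -> T) (phi : qf Sg V) : Prop :=
  match phi with
  | QAtom a => sat_atom I v a
  | QFalse => False
  | QNot f => ~ sat I v f
  | QAnd f g => sat I v f /\ sat I v g
  | QOr f g => sat I v f \/ sat I v g
  end.

Inductive literal (Sg : signature) (V : Type) :=
  | Pos of atom Sg V
  | Neg of atom Sg V.

Definition sat_literal (Sg : signature) (T V : Type) (I : interp Sg T)
    (v : V -> T) (l : literal Sg V) : Prop :=
  match l with
  | Pos a => sat_atom I v a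
  | Neg a => ~ sat_atom I v a
  end.

Definition atp (Sg : signature) (T : Type) (k : nat) (I : interp Sg T)
    (t : k.-tuple T) : set (literal Sg 'I_k) :=
  [set l | sat_literal I (tnth t) l].

(* The variables of a formula phi(x, y, z) with |x| = k, |y| = l, |z| = 1. *)
Inductive gvar (k l : nat) :=
  | VX of 'I_k
  | VY of 'I_l
  | VZ.

Definition gval (T : Type) (k l : nat) (a : k.-tuple T) (b : l.-tuple T)
    (c : T) (v : gvar k l) : T :=
  match v with
  | VX i => tnth a i
  | VY j => tnth b j
  | VZ => c
  end.

Definition defines_grid (Sg : signature) (k l : nat) (phi : qf Sg (gvar k l))
    (S : structure Sg) (n : nat) : Prop :=
  exists (A : set (k.-tuple S)) (B : set (l.-tuple S)) (C : set S),
    [/\ A #= `I_n, B #= `I_n, C #= `I_(n ^ 2) &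
        exists f : A * B -> C, bijective f /\
          forall (a : A) (b : B) (c : C),
            sat (inter S) (gval (val a) (val b) (val c)) phi <-> f (a, b) = c].

Definition defines_large_grids (Sg : signature) (k l : nat)
    (phi : qf Sg (gvar k l)) (C : structure Sg -> Prop) : Prop :=
  forall n : nat, exists S : structure Sg, C S /\ defines_grid phi S n.

Definition binary_interp (J : finType) (T : Type) (R : J -> T -> T -> Prop) :
    interp (Signature void void J) T :=
  Interp (Sg := Signature void void J) (of_void _) (of_void _) R.

Definition grid (m n : nat) : Type := 'I_m.+1 * 'I_n.+1.

Definition base (m n : nat) : set (grid m n) := [set p | p.1 = ord0].

Arguments base m n : clear implicits.

Definition base_proj (m n : nat) (p : grid m n) : base m n :=
  exist _ (ord0, p.2) (mem_set (erefl ord0)).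

Definition lex_le (m n : nat) (p q : grid m n) : bool :=
  ((p : 'I_m.+1 *l 'I_n.+1) <= q)%O.

(* The atomic type of (a, b) in (B, <=), where <= is the order of [I]. *)
Definition base_atp (Sg : signature) (le : sym2 Sg) (m n : nat)
    (I : interp Sg (grid m n)) (a b : base m n) :=
  atp (binary_interp (fun (_ : unit) (x y : base m n) =>
         rel2 I le (val x) (val y)))
      [tuple a; b].

(* The atomic type of (p, q) in (C, <=_1, <=_2); the symbol [false] stands for
   <=_1 and [true] for <=_2. *)
Definition grid_atp (m n : nat) (p q : grid m n) :=
  atp (binary_interp (fun (j : bool) (x y : grid m n) =>
         if j then (x.2 <= y.2)%N : Prop else (x.1 <= y.1)%N : Prop))
      [tuple p; q].

Definition regular_interp (Sg : signature) (le : sym2 Sg) (m n : nat)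
    (I : interp Sg (grid m n)) : Prop :=
  let B := base m n in
  let D := ~` base m n in
  [/\ (forall p q, rel2 I le p q <-> lex_le p q) \/
      (forall p q, rel2 I le p q <-> lex_le q p),
      forall a b a' b' : B,
        base_atp le I a b = base_atp le I a' b' ->
        atp I [tuple val a; val b] = atp I [tuple val a'; val b'],
      forall p q p' q' : D,
        grid_atp (val p) (val q) = grid_atp (val p') (val q') ->
        atp I [tuple val p; val q] = atp I [tuple val p'; val q'],
      forall (p : D) (b : B) (p' : D) (b' : B),
        base_atp le I (base_proj (val p)) b =
          base_atp le I (base_proj (val p')) b' ->
        atp I [tuple val p; val b] = atp I [tuple val p'; val b'] &
      exists (p : D) (b : B) (p' : D) (b' : B),
        atp I [tuple val p; val b] <> atp I [tuple val p'; val b']].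

Definition regular_semigrid (Sg : signature) (le : sym2 Sg) (m n : nat)
    (S : structure Sg) : Prop :=
  exists I : interp Sg (grid m n),
    regular_interp le I /\ isomorphic S (Structure I).

(* Main.v *)
(** Ramsey's theorem for products of pairs makes a large grid (a_i), (b_j), (c_ij)
    uniform: the type of a pair of entries depends only on how their indices
    compare.  Atoms are binary, so the only way phi can single out c_ij is that
    the type of (b_j, c_ij') depends non-trivially on the comparison of j and j'
    for some entry of the tuples b_j, and likewise for the a_i.  Uniformity forces
    the order on the c_ij to be row-major or column-major, and exchanging the roles
    of a and b we may assume the former.  Then all the b_j lie on one side of all
    the c_ij, and they form the base of a semigrid whose point (i, j) is
    c_{i (n+1) + j, j}: every point gets a row of its own, which makes the order
    lexicographic whatever it is inside a row; reversing rows and columns if needed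
    takes care of the direction of the order and of the order on the b_j. *)
Require Import Defs.
From mathcomp Require Import all_boot all_order.
From mathcomp Require Import boolp classical_sets functions cardinality.
From mathcomp Require Import zify.

Set Implicit Arguments.
Unset Strict Implicit.
Unset Printing Implicit Defensive.

(** * Ramsey's theorem for pairs and for products of pairs *)

Lemma pigeonhole_seq (K : finType) (T : Type) (f : T -> K) (n : nat) (s : seq T) :
  #|K| * n < size s -> exists k, n < count (fun x => f x == k) s.
Proof.
move=> lt_s; apply/existsP; apply: contraLR lt_s => /existsPn small.
have -> : size s = \sum_(k : K) count (fun x => f x == k) s.
  rewrite -sum1_size (partition_big f xpredT) //=.
  by apply: eq_bigr => k _; rewrite sum1_count.
rewrite -leqNgt -sum_nat_const; apply: leq_sum => k _.
by rewrite leqNgt; apply: small.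
Qed.

Section Ramsey.
Variable K : finType.

(** Keep the head [x], pass to a colour class of [chi x] on the tail with more than [N] elements,
    and recurse. Uniqueness keeps [x] out of the selected tail, so [d] can be overridden at [x]. *)
Lemma min_homogeneous (n : nat) : exists N, forall (T : eqType) (chi : T -> T -> K) (s : seq T),
  N <= size s -> exists t (d : T -> K),
    [/\ subseq t s, size t = n & uniq s -> pairwise (fun x y => chi x y == d x) t].
Proof.
elim: n => [|n [N IHN]].
  by exists 0 => T chi s _; exists [::], (fun x => chi x x); rewrite sub0seq.
exists (#|K| * N).+2 => T chi [//|x s]; rewrite ltnS => lt_s.
have [k lt_k] := pigeonhole_seq (chi x) lt_s.
have [|t [d [sub_t size_t hom_t]]] := IHN T chi [seq y <- s | chi x y == k].
  by rewrite size_filter ltnW.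
have sub_ts : subseq t s := subseq_trans sub_t (filter_subseq _ _).
exists (x :: t), (fun y => if y == x then k else d y).
split=> /=; rewrite ?eqxx ?size_t // => /andP[x_s uniq_s].
apply/andP; split.
  apply/allP => y t_y; have := mem_subseq sub_t t_y.
  by rewrite mem_filter => /andP[].
have x_t : x \notin t by apply: contra x_s; apply: (mem_subseq sub_ts).
have /hom_t : uniq [seq y <- s | chi x y == k] by apply: filter_uniq.
move: x_t; elim: t {sub_t size_t hom_t sub_ts} => //= y t IHt.
rewrite inE negb_or eq_sym => /andP[/negPf-> /IHt{}IHt] /andP[all_y /IHt->].
by rewrite andbT.
Qed.

(** A second pigeonhole, on the colours [d] attached to first elements, leaves a single colour; [h]
    increases because it enumerates a subsequence of [iota 0 N]. *)
Lemma ramsey_pairs (m : nat) : exists N, forall chi : nat -> nat -> K,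
  exists (h : nat -> nat) (k : K),
    [/\ forall i, i <= m -> h i < N,
        forall i j, i < j -> j <= m -> h i < h j &
        forall i j, i < j -> j <= m -> chi (h i) (h j) = k].
Proof.
have [N HN] := min_homogeneous (#|K| * m.+1).+1.
exists N => chi.
have [|t [d [sub_t size_t]]] := HN _ chi (iota 0 N); first by rewrite size_iota.
move=> /(_ (iota_uniq _ _)) hom_t.
have [k lt_k] : exists k, m.+1 < count (fun x => d x == k) t.
  by apply: pigeonhole_seq; rewrite size_t.
set u := [seq x <- t | d x == k].
have size_u : m.+1 < size u by rewrite size_filter.
have sub_u : subseq u (iota 0 N) := subseq_trans (filter_subseq _ _) sub_t.
have sort_u : sorted ltn u.
  by apply: (subseq_sorted _ sub_u (iota_ltn_sorted _ _)); apply: ltn_trans.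
have hom_u : pairwise (fun x y => chi x y == d x) u.
  exact: subseq_pairwise (filter_subseq _ _) hom_t.
have lt_u i : i <= m -> i < size u by move=> le_i; apply: leq_trans size_u; rewrite ltnS leqW.
have nth_u i : i <= m -> nth 0 u i \in u by move=> le_i; rewrite mem_nth ?lt_u.
exists (nth 0 u), k; split=> [i le_i|i j lt_ij le_j|i j lt_ij le_j].
- by have := mem_subseq sub_u (nth_u i le_i); rewrite mem_iota add0n.
- by apply: (sorted_ltn_nth ltn_trans) => //; rewrite inE lt_u // (leq_trans (ltnW lt_ij)).
- have hom := pairwiseP 0 hom_u.
  have /eqP -> : chi (nth 0 u i) (nth 0 u j) == d (nth 0 u i).
    by apply: (hom i j _ _ lt_ij); rewrite inE lt_u // (leq_trans (ltnW lt_ij)).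
  have := nth_u i (leq_trans (ltnW lt_ij) le_j).
  by rewrite mem_filter => /andP[/eqP].
Qed.

End Ramsey.

(** Row pairs are coloured by their whole table of colours over column pairs below [M]. Once that
    table is constant, Ramsey for columns is applied at the single row pair [h 0], [h m]. *)
Lemma ramsey_product (K : finType) (m : nat) :
  exists N, forall chi : nat -> nat -> nat -> nat -> K,
  exists (h g : nat -> nat) (k : K),
    [/\ forall i, i <= m -> h i < N /\ g i < N,
        forall i j, i < j -> j <= m -> h i < h j /\ g i < g j &
        forall i i' j j', i < i' -> i' <= m -> j < j' -> j' <= m ->
          chi (h i) (h i') (g j) (g j') = k].
Proof.
have [M HM] := ramsey_pairs K m.
have [N HN] := ramsey_pairs {ffun 'I_M * 'I_M -> K} m.
exists (maxn M N) => chi.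
have [h [F [ltN_h incr_h hom_h]]] :=
  HN (fun x x' => [ffun y : 'I_M * 'I_M => chi x x' y.1 y.2]).
have [g [k [ltM_g incr_g hom_g]]] :=
  HM (fun y y' => chi (h 0) (h m) y y').
exists h, g.
(* For [m = 0] there is no pair [h 0 < h m], but the colour claim is vacuous. *)
case: m => [|m] in HM HN ltN_h incr_h hom_h ltM_g incr_g hom_g *.
  exists k; split=> [i /[dup] /ltN_h ? /ltM_g ?|i j|i i' j j']; lia.
exists k; split=> [i /[dup] /ltN_h ? /ltM_g ?|i j lt_ij le_j|i i' j j' lt_i le_i lt_j le_j].
- lia.
- by split; [apply: incr_h|apply: incr_g].
- have lt_gj : g j < M by apply: ltM_g; lia.
  have lt_gj' : g j' < M by apply: ltM_g.
  pose y := (Ordinal lt_gj, Ordinal lt_gj').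
  have /ffunP/(_ y) := etrans (hom_h i i' lt_i le_i) (esym (hom_h 0 m.+1 isT (leqnn _))).
  by rewrite !ffunE /= => ->; apply: hom_g.
Qed.

(** * Types of pairs *)

Definition sel (T : Type) (x y : T) (b : bool) : T := if b then y else x.

(* The symbols of arity 0 are left out: they do not depend on the pair. *)
Definition pair_type (Sg : signature) (T : Type) (I : interp Sg T) (x y : T) :
    {ffun bool * bool -> bool} * {ffun sym1 Sg * bool -> bool} *
    {ffun sym2 Sg * (bool * bool) -> bool} :=
  ([ffun u => `[< sel x y u.1 = sel x y u.2 >]],
   [ffun u => `[< rel1 I u.1 (sel x y u.2) >]],
   [ffun u => `[< rel2 I u.1 (sel x y u.2.1) (sel x y u.2.2) >]]).

Section PairTypes.
Variables (Sg : signature).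

Lemma pair_typeP (T T' : Type) (I : interp Sg T) (I' : interp Sg T') x y x' y' :
  pair_type I x y = pair_type I' x' y' <->
  [/\ forall a b, sel x y a = sel x y b <-> sel x' y' a = sel x' y' b,
      forall s a, rel1 I s (sel x y a) <-> rel1 I' s (sel x' y' a) &
      forall s a b, rel2 I s (sel x y a) (sel x y b) <->
        rel2 I' s (sel x' y' a) (sel x' y' b)].
Proof.
split=> [[/ffunP eq0 /ffunP eq1 /ffunP eq2]|[eq0 eq1 eq2]].
  split=> [a b|s a|s a b]; apply: asbool_eq_equiv.
  - by have := eq0 (a, b); rewrite !ffunE.
  - by have := eq1 (s, a); rewrite !ffunE.
  - by have := eq2 (s, (a, b)); rewrite !ffunE.
by congr (_, _, _); apply/ffunP => u; rewrite !ffunE; apply: asbool_equiv_eq.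
Qed.

Variables (T : Type) (I : interp Sg T).
Implicit Types x y : T.

Lemma pair_type_sel x y x' y' a b : pair_type I x y = pair_type I x' y' ->
  pair_type I (sel x y a) (sel x y b) = pair_type I (sel x' y' a) (sel x' y' b).
Proof.
have selE z w c : sel (sel z w a) (sel z w b) c = sel z w (sel a b c) by case: c.
move=> /pair_typeP[eq0 eq1 eq2]; apply/pair_typeP.
by split=> *; rewrite !selE.
Qed.

Lemma pair_type_sym x y x' y' : pair_type I x y = pair_type I x' y' ->
  pair_type I y x = pair_type I y' x'.
Proof. exact: (@pair_type_sel x y x' y' true false). Qed.

Lemma pair_type_eq x y x' y' : pair_type I x y = pair_type I x' y' ->
  x = y <-> x' = y'.
Proof. by move=> /pair_typeP[/(_ false true)]. Qed.

Lemma pair_type_rel2 s x y x' y' : pair_type I x y = pair_type I x' y' ->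
  rel2 I s x y <-> rel2 I s x' y'.
Proof. by move=> /pair_typeP[_ _ /(_ s false true)]. Qed.

(** An atom mentions at most two variables, so one pair type decides it; nullary atoms agree because
    both sides share the interpretation. *)
Lemma sat_atom_pair_type (V : Type) (v v' : V -> T) (a : atom Sg V) :
  (forall u w, pair_type I (v u) (v w) = pair_type I (v' u) (v' w)) ->
  sat_atom I v a <-> sat_atom I v' a.
Proof.
move=> eq_v; case: a => [u w|s|s u|s u w] //=.
- exact: pair_type_eq.
- by have /pair_typeP[_ /(_ s false)] := eq_v u u.
- exact: pair_type_rel2.
Qed.

Lemma sat_pair_type (V : Type) (v v' : V -> T) (phi : qf Sg V) :
  (forall u w, pair_type I (v u) (v w) = pair_type I (v' u) (v' w)) ->
  sat I v phi <-> sat I v' phi.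
Proof.
move=> eq_v; elim: phi => [a||f [? ?]|f [? ?] g [? ?]|f [? ?] g [? ?]] /=;
  try tauto.
exact: sat_atom_pair_type.
Qed.

(** Bridge from the sets of literals that define regular semigrids to pair types, which form a
    finite type and can serve as Ramsey colours. *)
Lemma atp_pair_type x y x' y' :
  atp I [tuple x; y] = atp I [tuple x'; y'] <->
  pair_type I x y = pair_type I x' y'.
Proof.
have tnth_sel z w (b : bool) : tnth [tuple z; w] (if b then ord_max else ord0) = sel z w b.
  by case: b.
split=> [eq_atp|eq_xy].
  have eqP a : sat_atom I (tnth [tuple x; y]) a <-> sat_atom I (tnth [tuple x'; y']) a.
    have := congr1 (fun X : set _ => X (Pos a)) eq_atp.
    by rewrite /atp /= => ->.
  apply/pair_typeP; split=> [a b|s a|s a b]; rewrite -!tnth_sel.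
  - exact: (eqP (AEq _ _ _)).
  - exact: (eqP (ARel1 _ _)).
  - exact: (eqP (ARel2 _ _ _)).
have eqP a : sat_atom I (tnth [tuple x; y]) a <-> sat_atom I (tnth [tuple x'; y']) a.
  apply: sat_atom_pair_type => u w.
  have ord2 (i : 'I_2) : i = if i == ord_max then ord_max else ord0.
    by case: i => [[|[|]]] //= ?; apply/val_inj.
  by rewrite (ord2 u) (ord2 w) !tnth_sel; apply: pair_type_sel.
by rewrite predeqE => -[a|a]; rewrite /atp /=; have := eqP a; tauto.
Qed.

End PairTypes.

(** * Semigrids from homogeneous grids *)

(** Encodes the atomic type of a pair of indices in the order of the naturals. *)
Definition cmp (i j : nat) : bool * bool := (i <= j, j <= i).

Lemma cmp_sym i j k l : cmp i j = cmp k l -> cmp j i = cmp l k.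
Proof. by rewrite /cmp => -[-> ->]. Qed.

Lemma cmp_refl i j : cmp i i = cmp j j.
Proof. by rewrite /cmp !leqnn. Qed.

Lemma cmp_lt i j k l : i < j -> k < l -> cmp i j = cmp k l.
Proof. by move=> lt_ij lt_kl; congr (_, _); lia. Qed.

Definition pullback (Sg : signature) (T U : Type) (I : interp Sg T) (e : U -> T) : interp Sg U :=
  Interp (fun s => rel0 I s) (fun s x => rel1 I s (e x)) (fun s x y => rel2 I s (e x) (e y)).

Lemma pair_type_pullback (Sg : signature) (T U : Type) (I : interp Sg T) (e : U -> T) x y :
  injective e -> pair_type (pullback I e) x y = pair_type I (e x) (e y).
Proof.
move=> inj_e; have selE a : e (sel x y a) = sel (e x) (e y) a by case: a.
apply/pair_typeP; split=> [a b|s a|s a b] /=; rewrite -!selE //.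
by split=> [->//|/inj_e].
Qed.

(** [rho] is the identity or the reversal; the latter swaps the two components of [cmp], so
    homogeneity survives reindexing. *)
Lemma reindex_monotone (m : nat) (X : 'I_m -> 'I_m -> Prop) :
  (forall i j : 'I_m, i < j -> X i j) \/ (forall i j : 'I_m, i < j -> X j i) ->
  exists rho : 'I_m -> 'I_m,
    [/\ injective rho, forall i j : 'I_m, i < j -> X (rho i) (rho j) &
        forall i j k l : 'I_m, cmp i j = cmp k l -> cmp (rho i) (rho j) = cmp (rho k) (rho l)].
Proof.
case=> monoX; first by exists id; split=> //; apply: inj_id.
exists (@rev_ord m); split=> [|i j lt_ij|i j k l]; first exact: rev_ord_inj.
- by apply: monoX => /=; have := ltn_ord j; lia.
- rewrite /cmp /= => -[eq1 eq2].
  have [] := (ltn_ord i, ltn_ord j); have [] := (ltn_ord k, ltn_ord l).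
  by move=> *; congr (_, _); lia.
Qed.

Lemma lex_leE (m n : nat) (p q : grid m n) :
  lex_le p q = (p.1 < q.1) || (p.1 == q.1) && (p.2 <= q.2).
Proof.
rewrite /lex_le Order.ProdLexiOrder.leEprodlexi -val_eqE /= !Order.OrdinalOrder.leEord.
by case: (ltngtP p.1 q.1).
Qed.

Lemma leq_lex_code (n i i' : nat) (j j' : 'I_n.+1) :
  (i * n.+1 + j <= i' * n.+1 + j') = (i < i') || (i == i') && (j <= j').
Proof.
have := ltn_ord j; have := ltn_ord j'; move: (j : nat) (j' : nat) => {}j {}j' ltj' ltj.
case: (ltngtP i i') => [lt_i|lt_i|->] /=; first by nia.
- by apply/negbTE; nia.
- by rewrite leq_add2l.
Qed.

(** * The order on a homogeneous grid and its base *)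

Section Semigrid.
Variables (Sg : signature) (le : sym2 Sg) (T : Type) (I : interp Sg T).
Hypothesis total_le : total_order (rel2 I le).
Notation tp := (pair_type I).

(** Strict order in direction [d]: [false] is the given order, [true] its inverse. *)
Definition ltR (d : bool) (x y : T) : Prop :=
  if d then ~ rel2 I le x y else ~ rel2 I le y x.

Lemma ltR_flip d x y : ltR (~~ d) x y <-> ltR d y x.
Proof. by case: d. Qed.

Lemma ltR_neq d x y : ltR d x y -> x <> y.
Proof. by case: total_le => refl _ _ _; case: d => /= /[swap] ->; apply. Qed.

Lemma ltR_asym d x y : ltR d x y -> ltR d y x -> False.
Proof. by case: total_le => _ _ _ /(_ x y); case: d => /=; tauto. Qed.

Lemma ltR_total d x y : x <> y -> ltR d x y \/ ltR d y x.
Proof.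
case: total_le => _ anti _ _ neq_xy; apply: contrapT => nlt.
by apply: neq_xy; apply: anti; apply: contrapT; case: d nlt => /=; tauto.
Qed.

Lemma ltR_trans d y x z : ltR d x y -> ltR d y z -> ltR d x z.
Proof.
case: total_le => _ _ trans tot.
case: d => /= nxy nyz le_z.
  have [//|le_yx] := tot x y.
  by apply: nyz; apply: trans le_yx le_z.
have [le_xy|//] := tot x y.
by apply: nyz; apply: trans le_z le_xy.
Qed.

Lemma ltR_tp d x y x' y' : ltR d x y -> tp x y = tp x' y' -> ltR d x' y'.
Proof.
move=> + eq_tp; have := pair_type_rel2 le eq_tp.
have := pair_type_rel2 le (pair_type_sym eq_tp).
by case: d => /=; tauto.
Qed.

Section Grid.
Variable M : nat.
Let m := M.+3.

Definition homogeneous (c : 'I_m -> 'I_m -> T) :=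
  forall i i' j j' k k' l l' : 'I_m,
    cmp i i' = cmp k k' -> cmp j j' = cmp l l' ->
    tp (c i j) (c i' j') = tp (c k l) (c k' l').

Definition row_major d (c : 'I_m -> 'I_m -> T) :=
  forall i i' j j' : 'I_m, i < i' -> ltR d (c i j) (c i' j').

(** Conditions (1) and (3) of a regular semigrid, with column indices compared by [cmp]; the last
    clause is non-constancy. *)
Definition base_compatible (b : 'I_m -> T) (c : 'I_m -> 'I_m -> T) :=
  [/\ forall j j' l l' : 'I_m, cmp j j' = cmp l l' -> tp (b j) (b j') = tp (b l) (b l'),
      forall i k j j' l l' : 'I_m, cmp j j' = cmp l l' ->
        tp (b j) (c i j') = tp (b l) (c k l') &
      exists i j j' l l', tp (b j) (c i j') <> tp (b l) (c i l')].

Lemma agree_row_major d c : homogeneous c ->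
  ltR d (c (inord 0) (inord 0)) (c (inord 1) (inord 1)) ->
  ltR d (c (inord 0) (inord 1)) (c (inord 1) (inord 0)) ->
  row_major d c.
Proof.
move=> hom_c lt_asc lt_desc i i' j j' lt_i.
have asc (k k' l l' : 'I_m) : k < k' -> l < l' -> ltR d (c k l) (c k' l').
  move=> lt_k lt_l; apply: (ltR_tp lt_asc).
  by apply: hom_c; apply: cmp_lt; rewrite ?inordK.
have desc (k k' l l' : 'I_m) : k < k' -> l' < l -> ltR d (c k l) (c k' l').
  move=> lt_k lt_l; apply: (ltR_tp lt_desc).
  by apply: hom_c; [|apply: cmp_sym]; apply: cmp_lt; rewrite ?inordK.
case: (ltngtP j j') => [lt_j|lt_j|/val_inj<-]; [exact: asc|exact: desc|].
(* Within one column, row 0 reaches row 2 through row 1 and column 1, by one ascending and one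
   descending step. *)
have : ltR d (c (inord 0) (inord 0)) (c (inord 2) (inord 0)).
  apply: (@ltR_trans _ (c (inord 1) (inord 1))).
    by apply: asc; rewrite !inordK.
  by apply: desc; rewrite !inordK.
move/ltR_tp; apply; apply: hom_c; last exact: cmp_refl.
by apply: cmp_lt; rewrite ?inordK.
Qed.

(** The ascending diagonal fixes [d]. If the descending one agrees, rows dominate; otherwise it
    agrees in the transposed grid. *)
Lemma row_or_column_major c : homogeneous c ->
  (forall i j k l, c i j = c k l -> i = k /\ j = l) ->
  exists d, row_major d c \/ row_major d (fun i j => c j i).
Proof.
move=> hom_c inj_c.
have homT : homogeneous (fun i j => c j i) by move=> i i' j j' k k' l l' *; apply: hom_c.
have neq01 : @inord M.+2 0 <> inord 1 by move=> /(congr1 val); rewrite /= !inordK.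
have [d lt_asc] : exists d, ltR d (c (inord 0) (inord 0)) (c (inord 1) (inord 1)).
  have /(ltR_total true)[lt|lt] : c (inord 0) (inord 0) <> c (inord 1) (inord 1).
    by move=> /inj_c[/neq01].
    by exists true.
  by exists false; apply/(ltR_flip true).
exists d.
have /(ltR_total d)[lt|lt] : c (inord 0) (inord 1) <> c (inord 1) (inord 0).
  by move=> /inj_c[/neq01].
  by left; apply: agree_row_major.
by right; apply: agree_row_major.
Qed.

Lemma base_side d b c : base_compatible b c -> row_major d c ->
  exists d', forall i j j', ltR d' (b j) (c i j').
Proof.
case=> _ hom_bc _ row_c.
(* The type of [b j] with an entry of column [j'] ignores the row, so one equality would identify
   entries in two different rows. *)
have neq_bc j i j' : b j <> c i j'.
  move=> eq_bc; have : b j = c (inord 0) j'.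
    exact/(pair_type_eq (hom_bc i _ j j' j j' (erefl _))).
  have -> : b j = c (inord 1) j'.
    exact/(pair_type_eq (hom_bc i _ j j' j j' (erefl _))).
  move=> eq_c; have /ltR_neq[] : ltR d (c (inord 0) j') (c (inord 1) j').
    by apply: row_c; rewrite !inordK.
  by rewrite eq_c.
(* Were [b (inord 1)] between columns [l'] and [l], all of one column would precede all of the
   other, against row-major order for suitable rows. *)
have same l l' d' : ltR d' (b (inord 1)) (c (inord 0) l) -> ltR d' (b (inord 1)) (c (inord 0) l').
  move=> lt_l; have [//|lt_l'] := ltR_total d' (@neq_bc (inord 1) (inord 0) l').
  have all_l i : ltR d' (b (inord 1)) (c i l) by apply: (ltR_tp lt_l); apply: hom_bc.
  have all_l' i : ltR d' (c i l') (b (inord 1)).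
      by apply: (ltR_tp lt_l'); apply/pair_type_sym/hom_bc.
  have all_ll i i' : ltR d' (c i l') (c i' l) by apply: ltR_trans (all_l' i) (all_l i').
  have lt_c l1 l2 : ltR d (c (inord 0) l1) (c (inord 1) l2) by apply: row_c; rewrite !inordK.
  have : d' = d \/ d' = ~~ d by case: (d) (d') => [] []; tauto.
  case=> ?; subst d'; first by case: (ltR_asym (lt_c l l') (all_ll _ _)).
  by case: (ltR_asym (lt_c l' l)); apply/ltR_flip; apply: all_ll.
have [d' lt_d'] : exists d', ltR d' (b (inord 1)) (c (inord 0) (inord 0)).
  have [lt|lt] := ltR_total true (@neq_bc (inord 1) (inord 0) (inord 0)).
    by exists true.
  by exists false; apply/(ltR_flip true).
exists d' => i j j'.
(* Index 1 has a neighbour on each side, so comparing it with 0, 1 and 2 realises every comparison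
   type. *)
have [l /esym eq_cmp] : exists l : 'I_m, cmp j j' = cmp (inord 1 : 'I_m) l.
  case: (ltngtP j j') => [lt|lt|->].
  - by exists (inord 2); apply: cmp_lt; rewrite ?inordK.
  - by exists (inord 0); apply/cmp_sym/cmp_lt; rewrite ?inordK.
  - by exists (inord 1); apply: cmp_refl.
by apply: (ltR_tp (same _ l _ lt_d')); apply: hom_bc.
Qed.

(** By homogeneity it suffices that [b] is not constant. Were it constant, [b j] could be replaced
    by [b j'] next to [c i j'], and the types would not vary. *)
Lemma base_monotone d b c : base_compatible b c ->
  (forall i j : 'I_m, i < j -> ltR d (b i) (b j)) \/
  (forall i j : 'I_m, i < j -> ltR d (b j) (b i)).
Proof.
case=> hom_b hom_bc [i [j [j' [l [l' neq_tp]]]]].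
have /(ltR_total d) : b (inord 0) <> b (inord 1).
  move=> eq_b; apply: neq_tp.
  have const (k k' : 'I_m) : b k = b k'.
    case: (ltngtP k k') => [lt_k|lt_k|/val_inj->//]; last apply: esym;
      apply: (proj1 (pair_type_eq _) eq_b); apply: hom_b; apply: cmp_lt; by rewrite ?inordK.
  by rewrite (const j j') (const l l'); apply: hom_bc; apply: cmp_refl.
case=> lt_b; [left|right] => k k' lt_k; apply: (ltR_tp lt_b); last apply/pair_type_sym;
  apply: hom_b; apply: cmp_lt; by rewrite ?inordK.
Qed.

(** * The embedding of the semigrid *)

Variable n : nat.

(** Each point outside the base gets its own row, coded lexicographically; [n.+2] is the row length
    of [grid n.+1 n.+1], so codes stay below [n.+2 * n.+2]. *)
Definition embed (b : 'I_m -> T) (c : 'I_m -> 'I_m -> T) (rho sigma : 'I_m -> 'I_m)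
    (p : grid n.+1 n.+1) : T :=
  if p.1 == ord0 then b (sigma (inord p.2))
  else c (rho (inord (p.1 * n.+2 + p.2))) (sigma (inord p.2)).

Lemma embed_regular d b c (rho sigma : 'I_m -> 'I_m) :
  n.+2 * n.+2 <= m -> homogeneous c -> base_compatible b c ->
  (forall i j j', ltR d (b j) (c i j')) ->
  injective rho -> injective sigma ->
  (forall i i' : 'I_m, i < i' -> forall j j', ltR d (c (rho i) j) (c (rho i') j')) ->
  (forall j j' : 'I_m, j < j' -> ltR d (b (sigma j)) (b (sigma j'))) ->
  (forall i j k l : 'I_m, cmp i j = cmp k l -> cmp (rho i) (rho j) = cmp (rho k) (rho l)) ->
  (forall i j k l : 'I_m, cmp i j = cmp k l -> cmp (sigma i) (sigma j) = cmp (sigma k) (sigma l)) ->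
  let e := embed b c rho sigma in
  injective e /\ regular_interp le (pullback I e).
Proof.
move=> lt_n_m hom_c [hom_b hom_bc nc_bc] lt_bc inj_rho inj_sigma lt_c lt_b cmp_rho cmp_sigma e.
have codeK (p : grid n.+1 n.+1) : (inord (p.1 * n.+2 + p.2) : 'I_m) = p.1 * n.+2 + p.2 :> nat.
  rewrite inordK //; have := ltn_ord p.1; have := ltn_ord p.2; rewrite /m in lt_n_m; nia.
have colK (j : 'I_n.+2) : (inord j : 'I_m) = j :> nat.
  by rewrite inordK //; have := ltn_ord j; rewrite /m in lt_n_m; nia.
have lt_code (p q : grid n.+1 n.+1) : ~~ lex_le q p ->
    (inord (p.1 * n.+2 + p.2) : 'I_m) < (inord (q.1 * n.+2 + q.2) : 'I_m).
  by rewrite lex_leE -val_eqE => nle_qp; rewrite !codeK ltnNge leq_lex_code.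
(* Strict monotonicity from the lexicographic order to direction [d] yields both injectivity and the
   order clause. *)
have mono_e p q : ~~ lex_le q p -> ltR d (e p) (e q).
  move=> lt_pq; have lt_code_pq := lt_code _ _ lt_pq; move: lt_pq.
  rewrite lex_leE /e /embed -!val_eqE /= => lt_pq.
  case: (eqVneq (p.1 : nat) 0) => p0; case: (eqVneq (q.1 : nat) 0) => q0.
  - by apply: lt_b; rewrite !colK; lia.
  - exact: lt_bc.
  - by lia.
  - exact: lt_c.
have lex_total p q : p <> q -> ~~ lex_le p q || ~~ lex_le q p.
  move=> neq_pq; rewrite -negb_and; apply/negP => /andP[]; rewrite !lex_leE -!val_eqE /=.
  move=> le_pq le_qp; apply: neq_pq.
  by case: p q le_pq le_qp => [i j] [i' j'] /= ? ?; congr (_, _); apply: val_inj => /=; lia.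
have inj_e : injective e.
  move=> p q eq_e; apply: contrapT => /lex_total/orP[] /mono_e/ltR_neq; exact.
have ordE p q : (if d then rel2 I le (e q) (e p) else rel2 I le (e p) (e q)) <-> lex_le p q.
  split=> [|le_pq].
    move=> le_e; apply: contraT => /mono_e; case: d le_e {lt_bc lt_c lt_b mono_e} => /= *; tauto.
  have [refl _ _ tot] := total_le.
  have [->|/lex_total] := pselect (p = q); first by case: d {lt_bc lt_c lt_b mono_e}.
  rewrite le_pq /= => /mono_e; have := tot (e p) (e q).
  by case: d {lt_bc lt_c lt_b mono_e} => /=; tauto.
have baseE (x : base n.+1 n.+1) : (val x).1 = ord0 by have := set_valP x.
have cmp_base (x y x' y' : base n.+1 n.+1) :
    base_atp le (pullback I e) x y = base_atp le (pullback I e) x' y' ->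
    cmp (val x).2 (val y).2 = cmp (val x').2 (val y').2.
  rewrite /base_atp => /atp_pair_type eq_tp.
  have := pair_type_rel2 (tt : sym2 (Signature void void unit)) eq_tp.
  have := pair_type_rel2 (tt : sym2 (Signature void void unit)) (pair_type_sym eq_tp) => /=.
  have lexE (z w : base n.+1 n.+1) : ((val z).2 <= (val w).2) = lex_le (val z) (val w).
    by rewrite lex_leE !baseE.
  rewrite /cmp !lexE => iff1 iff2.
  by congr (_, _); apply/idP/idP; rewrite -!ordE; case: d {lt_bc lt_c lt_b mono_e ordE} ; tauto.
have tpE p q p' q' : tp (e p) (e q) = tp (e p') (e q') ->
    atp (pullback I e) [tuple p; q] = atp (pullback I e) [tuple p'; q'].
  by move=> eq_tp; apply/atp_pair_type; rewrite !pair_type_pullback.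
have cmp_col (j j' k k' : 'I_n.+2) : cmp j j' = cmp k k' ->
    cmp (sigma (inord j)) (sigma (inord j')) = cmp (sigma (inord k)) (sigma (inord k')).
  by move=> eq_cmp; apply: cmp_sigma; rewrite /cmp !colK.
have e_base (x : base n.+1 n.+1) : e (val x) = b (sigma (inord (val x).2)).
  by rewrite /e /embed baseE eqxx.
have e_free (p : (~` base n.+1 n.+1)%classic) :
    e (val p) = c (rho (inord ((val p).1 * n.+2 + (val p).2))) (sigma (inord (val p).2)).
  rewrite /e /embed; case: eqP => // p0; by have := set_valP p => /(_ p0).
split=> //; split.
- by case: d ordE {lt_bc lt_c lt_b mono_e} => ordE; [right|left] => p q; rewrite -ordE.
- move=> x y x' y' /cmp_base eq_cmp; apply: tpE; rewrite !e_base.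
  exact/hom_b/cmp_col.
- move=> p q p' q' /atp_pair_type eq_tp; apply: tpE; rewrite !e_free.
  have /= r1 := pair_type_rel2 (false : sym2 (Signature void void bool)) eq_tp.
  have /= r2 := pair_type_rel2 (false : sym2 (Signature void void bool)) (pair_type_sym eq_tp).
  have /= r3 := pair_type_rel2 (true : sym2 (Signature void void bool)) eq_tp.
  have /= r4 := pair_type_rel2 (true : sym2 (Signature void void bool)) (pair_type_sym eq_tp).
  have cmp2 : cmp (val p).2 (val q).2 = cmp (val p').2 (val q').2.
    by congr (_, _); apply/idP/idP; tauto.
  have cmp1 : cmp (val p).1 (val q).1 = cmp (val p').1 (val q').1.
    by congr (_, _); apply/idP/idP; tauto.
  (* The comparison of two codes is determined by the comparisons of rows and of columns. *)
  apply: hom_c; last exact: cmp_col.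
  apply: cmp_rho; rewrite /cmp !codeK !leq_lex_code.
  by case: cmp1 cmp2 => [? ?] [? ?]; congr (_, _); lia.
- move=> p x p' x' /cmp_base /= eq_cmp; apply: tpE; rewrite !e_base !e_free.
  exact/pair_type_sym/hom_bc/cmp_sym/cmp_col.
- apply: contrapT => const.
  case: nc_bc => i [j [j' [l [l']]]]; apply.
  (* Two columns suffice: they realise every comparison type, even if [sigma] reverses them. [x1] is
     also the row index of the chosen points outside the base. *)
  pose x0 : 'I_n.+2 := inord 0; pose x1 : 'I_n.+2 := inord 1.
  have realize (k k' : 'I_m) : exists x y : 'I_n.+2,
      cmp k k' = cmp (sigma (inord x)) (sigma (inord y)).
    have neq : sigma (inord x0) <> sigma (inord x1).
      by move=> /inj_sigma/(congr1 val); rewrite /= !colK !inordK.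
    case: (ltngtP k k') => [lt_k|lt_k|->]; last by exists x0, x0; apply: cmp_refl.
      case: (ltngtP (sigma (inord x0)) (sigma (inord x1))) => [lt|lt|/val_inj//].
        by exists x0, x1; apply: cmp_lt.
      by exists x1, x0; apply: cmp_lt.
    case: (ltngtP (sigma (inord x0)) (sigma (inord x1))) => [lt|lt|/val_inj//].
      by exists x1, x0; apply/cmp_sym/cmp_lt.
    by exists x0, x1; apply/cmp_sym/cmp_lt.
  have [x [y cmp_j]] := realize j j'; have [z [w cmp_l]] := realize l l'.
  have free (u : 'I_n.+2) : (~` base n.+1 n.+1)%classic (x1, u).
    by rewrite /base /= => /(congr1 val); rewrite /= inordK.
  pose D u : (~` base n.+1 n.+1)%classic := exist _ (x1, u) (mem_set (free u)).
  pose B u : base n.+1 n.+1 := exist _ (ord0, u) (mem_set (erefl ord0)).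
  have /atp_pair_type eq_yx : atp (pullback I e) [tuple val (D y); val (B x)] =
         atp (pullback I e) [tuple val (D w); val (B z)].
    by apply: contrapT => neq; apply: const; exists (D y), (B x), (D w), (B z).
  have := pair_type_sym eq_yx; rewrite !pair_type_pullback // !e_base !e_free /= => eq_tp.
  apply: etrans (hom_bc _ _ _ _ _ _ cmp_j) (etrans eq_tp _).
  by apply: hom_bc; rewrite cmp_l.
Qed.

(** The side on which the base lies fixes the direction [d'] in which it comes first; rows and
    columns are then reversed where needed to increase in that direction. *)
Lemma row_major_semigrid d b c : n.+2 * n.+2 <= m ->
  homogeneous c -> base_compatible b c -> row_major d c ->
  exists e : grid n.+1 n.+1 -> T, injective e /\ regular_interp le (pullback I e).
Proof.
move=> lt_n_m hom_c comp_bc row_c.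
have [d' lt_bc] := base_side comp_bc row_c.
pose lt_row (i i' : 'I_m) := forall j j', ltR d' (c i j) (c i' j').
have mono_row : (forall i i' : 'I_m, i < i' -> lt_row i i') \/
                (forall i i' : 'I_m, i < i' -> lt_row i' i).
  have [?|?] : d' = d \/ d' = ~~ d by case: (d) (d') => [] []; tauto.
    by subst d'; left=> i i' lt_i j j'; apply: row_c.
  by subst d'; right=> i i' lt_i j j'; apply/ltR_flip/row_c.
have [rho [inj_rho lt_c cmp_rho]] := reindex_monotone mono_row.
have [sigma [inj_sigma lt_b cmp_sigma]] := reindex_monotone (base_monotone d' comp_bc).
by exists (embed b c rho sigma); apply: embed_regular lt_bc _ _ _ _ _ _.
Qed.

End Grid.
End Semigrid.

(** * Homogeneous grids from formulas defining large grids *)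

Lemma regular_semigrid_of_embedding (Sg : signature) (le : sym2 Sg)
    (C : structure Sg -> Prop) (S : structure Sg) (m n : nat) (e : grid m n -> S) :
  hereditary C -> C S -> injective e -> regular_interp le (pullback (inter S) e) ->
  exists S', C S' /\ regular_semigrid le m n S'.
Proof.
move=> [_ herC] CS inj_e reg_e.
exists (induced (range e)); split; first exact: herC.
exists (pullback (inter S) e); split=> //.
have preim (x : range e) : exists p, e p = val x by have [p _ <-] := set_valP x; exists p.
pose f (x : range e) := projT1 (cid (preim x)).
have fK x : e (f x) = val x by rewrite /f; case: cid.
exists f; split; last by split=> [s|s x|s x y] /=; rewrite ?fK.
pose g p : range e := exist _ (e p) (mem_set (imageT e p)).
exists g => [x|p]; first by apply/val_inj/fK.
by apply: inj_e; rewrite fK.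
Qed.

(** Enumerate [A] and [B] and index the entries of [C] through the bijection [f], whose injectivity
    turns its graph into equality of indices. *)
Lemma defines_grid_indexed (Sg : signature) (k l : nat) (phi : qf Sg (gvar k l))
    (S : structure Sg) (n : nat) :
  defines_grid phi S n ->
  exists (a : 'I_n -> k.-tuple S) (b : 'I_n -> l.-tuple S) (c : 'I_n -> 'I_n -> S),
    forall i j i' j',
      sat (inter S) (gval (a i) (b j) (c i' j')) phi <-> i = i' /\ j = j'.
Proof.
case=> A [B [C [cardA cardB _ [f [bij_f sat_f]]]]].
have enum X (D : set X) : (D #= `I_n)%card -> exists u : 'I_n -> D, injective u.
  rewrite card_eq_sym => /card_bijP[u /bij_inj inj_u].
  exists (fun i => u (exist _ (val i) (mem_set (ltn_ord i)))).
  by move=> i j /inj_u [] /val_inj.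
have [a inj_a] := enum _ _ cardA; have [b inj_b] := enum _ _ cardB.
exists (val \o a), (val \o b), (fun i j => val (f (a i, b j))) => i j i' j'.
rewrite /= sat_f; split=> [/(bij_inj bij_f)[/inj_a-> /inj_b->]//|[-> ->]//].
Qed.

(** * Uniform grids *)

Section UniformGrid.
Variables (Sg : signature) (le : sym2 Sg) (T : Type) (I : interp Sg T).
Hypothesis total_le : total_order (rel2 I le).
Notation tp := (pair_type I).
Variables (k l : nat).

(** Positions in the configuration spanned by two rows and two columns: coordinates of the two [a]
    tuples and of the two [b] tuples, and the four [c] entries. *)
Definition role : finType := (bool * 'I_k + bool * 'I_l + bool * bool)%type.

Definition entry (a : nat -> k.-tuple T) (b : nat -> l.-tuple T) (c : nat -> nat -> T)
    (i i' j j' : nat) (r : role) : T :=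
  match r with
  | inl (inl (u, s)) => tnth (a (sel i i' u)) s
  | inl (inr (u, s)) => tnth (b (sel j j' u)) s
  | inr (u, w) => c (sel i i' u) (sel j j' w)
  end.

Definition uniform m a b c := forall i i' j j' p p' q q',
  i < i' -> i' <= m -> j < j' -> j' <= m -> p < p' -> p' <= m -> q < q' -> q' <= m ->
  forall r r', tp (entry a b c i i' j j' r) (entry a b c i i' j j' r') =
               tp (entry a b c p p' q q' r) (entry a b c p p' q q' r').

(* The index m itself only serves as the larger element of a pair {i, m}. *)
Lemma frame m i i' : i < m -> i' < m -> exists x x',
  [/\ x < x', x' <= m, sel x x' (~~ (i <= i')) = i & sel x x' (~~ (i' <= i)) = i'].
Proof.
move=> lt_i lt_i'; case: (ltngtP i i') => cmp_i /=.
- by exists i, i'; split=> //; apply: ltnW.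
- by exists i', i; split=> //; apply: ltnW.
- by exists i, m; split.
Qed.

Variables (M : nat) (a : nat -> k.-tuple T) (b : nat -> l.-tuple T) (c : nat -> nat -> T).
Hypothesis unif : uniform M.+3 a b c.

(** [frame] puts two indices into an increasing pair, at positions that depend only on their [cmp];
    equal comparisons thus give equal roles. *)
Lemma uniform_homogeneous : homogeneous I (fun i j : 'I_M.+3 => c i j).
Proof.
move=> i i' j j' p p' q q' eq1 eq2.
have [x1 [y1 [lt1 le1 E1 E1']]] := frame (ltn_ord i) (ltn_ord i').
have [x2 [y2 [lt2 le2 E2 E2']]] := frame (ltn_ord j) (ltn_ord j').
have [x3 [y3 [lt3 le3 E3 E3']]] := frame (ltn_ord p) (ltn_ord p').
have [x4 [y4 [lt4 le4 E4 E4']]] := frame (ltn_ord q) (ltn_ord q').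
have := unif lt1 le1 lt2 le2 lt3 le3 lt4 le4
  (inr (~~ (i <= i'), ~~ (j <= j'))) (inr (~~ (i' <= i), ~~ (j' <= j))).
rewrite /= E1 E1' E2 E2'; case: eq1 eq2 => -> -> [-> ->].
by rewrite E3 E3' E4 E4'.
Qed.

Lemma uniform_a_a s (i i' p p' : 'I_M.+3) : cmp i i' = cmp p p' ->
  tp (tnth (a i) s) (tnth (a i') s) = tp (tnth (a p) s) (tnth (a p') s).
Proof.
move=> eq1.
have [x1 [y1 [lt1 le1 E1 E1']]] := frame (ltn_ord i) (ltn_ord i').
have [x3 [y3 [lt3 le3 E3 E3']]] := frame (ltn_ord p) (ltn_ord p').
have := unif lt1 le1 (ltn0Sn 0) (ltn0Sn _) lt3 le3 (ltn0Sn 0) (ltn0Sn _)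
  (inl (inl (~~ (i <= i'), s))) (inl (inl (~~ (i' <= i), s))).
by rewrite /= E1 E1'; case: eq1 => -> ->; rewrite E3 E3'.
Qed.

Lemma uniform_b_b s (j j' q q' : 'I_M.+3) : cmp j j' = cmp q q' ->
  tp (tnth (b j) s) (tnth (b j') s) = tp (tnth (b q) s) (tnth (b q') s).
Proof.
move=> eq1.
have [x1 [y1 [lt1 le1 E1 E1']]] := frame (ltn_ord j) (ltn_ord j').
have [x3 [y3 [lt3 le3 E3 E3']]] := frame (ltn_ord q) (ltn_ord q').
have := unif (ltn0Sn 0) (ltn0Sn _) lt1 le1 (ltn0Sn 0) (ltn0Sn _) lt3 le3
  (inl (inr (~~ (j <= j'), s))) (inl (inr (~~ (j' <= j), s))).
by rewrite /= E1 E1'; case: eq1 => -> ->; rewrite E3 E3'.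
Qed.

Lemma uniform_a_c s (i i' p p' j q : 'I_M.+3) : cmp i i' = cmp p p' ->
  tp (tnth (a i) s) (c i' j) = tp (tnth (a p) s) (c p' q).
Proof.
move=> eq1.
have [x1 [y1 [lt1 le1 E1 E1']]] := frame (ltn_ord i) (ltn_ord i').
have [x3 [y3 [lt3 le3 E3 E3']]] := frame (ltn_ord p) (ltn_ord p').
(* Columns [j] and [q] are each taken as the smaller element of a pair with [M.+3], whatever their
   mutual order. *)
have := unif lt1 le1 (ltn_ord j) (leqnn _) lt3 le3 (ltn_ord q) (leqnn _)
  (inl (inl (~~ (i <= i'), s))) (inr (~~ (i' <= i), false)).
by rewrite /= E1 E1'; case: eq1 => -> ->; rewrite E3 E3'.
Qed.

Lemma uniform_b_c s (i p j j' q q' : 'I_M.+3) : cmp j j' = cmp q q' ->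
  tp (tnth (b j) s) (c i j') = tp (tnth (b q) s) (c p q').
Proof.
move=> eq1.
have [x1 [y1 [lt1 le1 E1 E1']]] := frame (ltn_ord j) (ltn_ord j').
have [x3 [y3 [lt3 le3 E3 E3']]] := frame (ltn_ord q) (ltn_ord q').
have := unif (ltn_ord i) (leqnn _) lt1 le1 (ltn_ord p) (leqnn _) lt3 le3
  (inl (inr (~~ (j <= j'), s))) (inr (false, ~~ (j' <= j))).
by rewrite /= E1 E1'; case: eq1 => -> ->; rewrite E3 E3'.
Qed.

Lemma sat_gval_pair_type (phi : qf Sg (gvar k l)) (ta : k.-tuple T) (tb : l.-tuple T) z z' :
  (forall s, tp (tnth ta s) z = tp (tnth ta s) z') ->
  (forall s, tp (tnth tb s) z = tp (tnth tb s) z') ->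
  tp z z = tp z' z' ->
  sat I (gval ta tb z) phi <-> sat I (gval ta tb z') phi.
Proof.
move=> eq_a eq_b eq_z; apply: sat_pair_type => -[s|s|] [s'|s'|] //=;
  by [apply: pair_type_sym].
Qed.

Variable phi : qf Sg (gvar k l).
Hypothesis sat_phi : forall i j i' j' : 'I_M.+3,
  sat I (gval (a i) (b j) (c i' j')) phi <-> i = i' /\ j = j'.

(** If no coordinate worked, the first and last entries of row 0 would have the same types over
    [a 0] and [b 0], and [phi] could not tell them apart. *)
Lemma entry_b_compatible :
  exists s, base_compatible I (fun j : 'I_M.+3 => tnth (b j) s) (fun i j : 'I_M.+3 => c i j).
Proof.
apply: contrapT => none.
suff : sat I (gval (a (@ord0 M.+2)) (b (@ord0 M.+2)) (c (@ord0 M.+2) (@ord_max M.+2))) phi.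
  by move/(sat_phi ord0 ord0 ord0 ord_max) => [_ /(congr1 val)].
apply/(@sat_gval_pair_type _ _ _ (c (@ord0 M.+2) (@ord0 M.+2)));
  last by apply/(sat_phi ord0 ord0 ord0 ord0).
- by move=> s; apply: (@uniform_a_c s ord0 ord0 ord0 ord0 ord0 ord_max).
- move=> s; apply: contrapT => neq; apply: none; exists s; split.
  + by move=> *; apply: uniform_b_b.
  + by move=> *; apply: uniform_b_c.
  + by exists ord0, ord0, ord0, ord0, ord_max.
- by apply: (@uniform_homogeneous ord0 ord0 ord0 ord0 ord0 ord0 ord_max ord_max); apply: cmp_refl.
Qed.

Lemma entry_a_compatible :
  exists s, base_compatible I (fun i : 'I_M.+3 => tnth (a i) s) (fun j i : 'I_M.+3 => c i j).
Proof.
apply: contrapT => none.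
suff : sat I (gval (a (@ord0 M.+2)) (b (@ord0 M.+2)) (c (@ord_max M.+2) (@ord0 M.+2))) phi.
  by move/(sat_phi ord0 ord0 ord_max ord0) => [/(congr1 val)].
apply/(@sat_gval_pair_type _ _ _ (c (@ord0 M.+2) (@ord0 M.+2)));
  last by apply/(sat_phi ord0 ord0 ord0 ord0).
- move=> s; apply: contrapT => neq; apply: none; exists s; split.
  + by move=> *; apply: uniform_a_a.
  + by move=> *; apply: uniform_a_c.
  + by exists ord0, ord0, ord0, ord0, ord_max.
- by move=> s; apply: (@uniform_b_c s ord0 ord_max ord0 ord0 ord0 ord0).
- by apply: (@uniform_homogeneous ord0 ord0 ord0 ord0 ord_max ord_max ord0 ord0); apply: cmp_refl.
Qed.

Lemma uniform_semigrid n : n.+2 * n.+2 <= M.+3 ->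
  exists e : grid n.+1 n.+1 -> T, injective e /\ regular_interp le (pullback I e).
Proof.
move=> le_nM.
have [s comp_b] := entry_b_compatible; have [s' comp_a] := entry_a_compatible.
have hom_c := uniform_homogeneous.
have [i j i' j' eq_c|d [row_c|col_c]] := row_or_column_major total_le hom_c.
(* [c] is injective, since [phi] ties each entry to its own indices. *)
- by apply/(sat_phi i j i' j'); rewrite -eq_c; apply/sat_phi.
- exact: row_major_semigrid comp_b row_c.
(* Here the grid is transposed and the [a] tuples supply the base. *)
- apply: row_major_semigrid comp_a col_c => //.
  by move=> *; apply: hom_c.
Qed.

End UniformGrid.

(** * From large grids to regular semigrids *)

Lemma large_grid_semigrid (Sg : signature) (le : sym2 Sg) (k l n : nat)
    (phi : qf Sg (gvar k l)) :
  exists N, forall S : structure Sg, ordered le S -> defines_grid phi S N ->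
    exists e : grid n.+1 n.+1 -> S,
      injective e /\ regular_interp le (pullback (inter S) e).
Proof.
set M := n.+2 * n.+2.
pose color : finType := ({ffun bool * bool -> bool} * {ffun sym1 Sg * bool -> bool} *
    {ffun sym2 Sg * (bool * bool) -> bool})%type.
have [N HN] := ramsey_product {ffun role k l * role k l -> color} M.+3.
(* Ramsey indices are below [N]; [inord] needs a successor bound. *)
exists N.+1 => S total_le /defines_grid_indexed[a [b [c sat_phi]]].
pose a' i := a (inord i); pose b' i := b (inord i); pose c' i j := c (inord i) (inord j).
(* The colour of two rows and two columns records the pair types of all pairs of roles. *)
have [h [g [K [ltN incr hom]]]] := HN (fun i i' j j' => [ffun r =>
  pair_type (inter S) (entry a' b' c' i i' j j' r.1) (entry a' b' c' i i' j j' r.2)]).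
have inj_idx (f : nat -> nat) : (forall i, i <= M.+3 -> f i < N) ->
    (forall i j, i < j -> j <= M.+3 -> f i < f j) ->
    forall i j : 'I_M.+3, inord (f i) = inord (f j) :> 'I_N.+1 -> i = j.
  move=> ltf incrf i j /(congr1 val); rewrite /= !inordK ?ltnS; last 2 first.
  - exact/ltnW/ltf/ltnW.
  - exact/ltnW/ltf/ltnW.
  case: (ltngtP i j) => [lt_ij|lt_ij|/val_inj//] eq_f.
  - by have := incrf _ _ lt_ij (ltnW (ltn_ord j)); rewrite eq_f ltnn.
  - by have := incrf _ _ lt_ij (ltnW (ltn_ord i)); rewrite eq_f ltnn.
have inj_h := inj_idx h (fun i le_i => proj1 (ltN i le_i)) (fun i j lt le => proj1 (incr i j lt le)).
have inj_g := inj_idx g (fun i le_i => proj2 (ltN i le_i)) (fun i j lt le => proj2 (incr i j lt le)).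
apply: (@uniform_semigrid _ le _ _ total_le k l M (a' \o h) (b' \o g)
          (fun i j => c' (h i) (g j)) _ phi) => [|i j i' j'|].
- have entryE i i' j j' r : entry (a' \o h) (b' \o g) (fun i j => c' (h i) (g j)) i i' j j' r =
      entry a' b' c' (h i) (h i') (g j) (g j') r.
    by case: r => [[[[] s]|[[] s]]|[[] []]].
  move=> i i' j j' p p' q q' lt1 le1 lt2 le2 lt3 le3 lt4 le4 r r'.
  have /ffunP/(_ (r, r')) := etrans (hom i i' j j' lt1 le1 lt2 le2)
    (esym (hom p p' q q' lt3 le3 lt4 le4)).
  by rewrite !ffunE !entryE.
- by rewrite sat_phi; split=> [[/inj_h-> /inj_g->]|[-> ->]].
- exact: leq_trans (leqnSn _) (leq_trans (leqnSn _) (leqnSn _)).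
Qed.

Theorem theorem3p6 (Sg : signature) (le : sym2 Sg) (C : structure Sg -> Prop)
    (ordC : forall S : structure Sg, C S -> ordered le S)
    (herC : hereditary C)
    (gridC : exists (k l : nat) (phi : qf Sg (gvar k l)),
        defines_large_grids phi C) :
  forall N : nat, exists n : nat, (N <= n)%N /\
    exists S : structure Sg, C S /\ regular_semigrid le n n S.
Proof.
move=> n; exists n.+1; split=> //.
have [k [l [phi large]]] := gridC.
have [N HN] := large_grid_semigrid le n phi.
have [S [CS /(HN S (ordC S CS))[e [inj_e reg_e]]]] := large N.
exact: regular_semigrid_of_embedding herC CS inj_e reg_e.
Qed.
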